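(* Let $[X,d,m]$ be a metric random walk space with a finite invariant measure $\nu$, and assume its Ollivier-Ricci curvature satisfies $\kappa_m>0$. Then $[X,d,m]$ with $\nu$ is $m$-connected and weakly strong $m$-connected.
   Context: A metric random walk space $[X,d,m]$ is a Polish metric space $(X,d)$ with a family $m=(m_x)_{x\in X}$ of Borel probability measures, $x\mapsto m_x(A)$ Borel measurable, each with finite first moment. A Radon measure $\nu$ is invariant if $\nu(A)=\int_X m_x(A)d\nu(x)$ for all $\nu$-measurable $A$. Iterates $m_x^{*1}=m_x$, $m_x^{*n}(A)=\int_X m_z(A)dm_x^{*(n-1)}(z)$; $N^m_D=\{x:m_x^{*n}(D)=0\ \forall n\in\mathbb N\}$. The space is $m$-connected if $\nu(N^m_D)=0$ for every $\nu$-measurable $D$ with $0<\nu(D)<\infty$. It is weakly strong $m$-connected if for every $0\le u_0\in L^2(X,\nu)\cap C(X)$ not $\nu$-a.e. zero, $e^{t\Delta_m}u_0(x)>0$ for all $x\in X$ and all $t>0$, where $e^{t\Delta_m}u_0(x)$ is understood pointwise as $e^{-t}\sum_{n\ge0}\frac{t^n}{n!}\int_X u_0\,dm_x^{*n}$ (with $m_x^{*0}=\delta_x$), $\Delta_m f(x)=\int_X(f(y)-f(x))dm_x(y)$. The $1$-Wasserstein distance between probability measures is $W_1^d(\mu,\mu')=\inf_{\gamma}\int_{X\times X} d(x,y)\,d\gamma(x,y)$ over couplings $\gamma$ of $\mu,\mu'$. The Ollivier-Ricci curvature is $\kappa_m=\inf_{x\ne y}\big(1-\frac{W_1^d(m_x,m_y)}{d(x,y)}\big)$.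 *)

(* Defs.v *)
From HB Require Import structures.
From mathcomp Require Import all_boot all_order all_algebra.
From mathcomp Require Import all_classical all_reals all_analysis.
Set Implicit Arguments. Unset Strict Implicit. Unset Printing Implicit Defensive.
Import Order.TTheory GRing.Theory Num.Theory.
Import numFieldNormedType.Exports.
Local Open Scope classical_set_scope.
Local Open Scope ring_scope.

Section metric.
Context {R : realType} {X : Type} (d : X -> X -> R).

Definition is_metric : Prop :=
  [/\ forall x y, 0 <= d x y,
      forall x y, d x y = 0 <-> x = y,
      forall x y, d x y = d y x &
      forall x y z, d x z <= d x y + d y z].

Definition d_ball (x : X) (r : R) : set X := [set y | d x y < r].

Definition d_open (U : set X) : Prop :=
  forall x, U x -> exists2 r : R, 0 < r & d_ball x r `<=` U.

Definition d_compact (K : set X) : Prop :=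
  forall (I : Type) (U : I -> set X), (forall i, d_open (U i)) ->
    K `<=` \bigcup_i U i ->
    exists F : set I, finite_set F /\ K `<=` \bigcup_(i in F) U i.

Definition d_complete : Prop :=
  forall u : nat -> X,
    (forall eps : R, 0 < eps -> exists N : nat,
       forall n k, (N <= n)%N -> (N <= k)%N -> d (u n) (u k) < eps) ->
    exists l : X, forall eps : R, 0 < eps -> exists N : nat,
       forall n, (N <= n)%N -> d (u n) l < eps.

Definition d_separable : Prop :=
  exists S : set X, countable S /\
    forall x (eps : R), 0 < eps -> exists2 y, S y & d x y < eps.

Definition polish_metric : Prop := [/\ is_metric, d_complete & d_separable].

Definition d_continuous (u : X -> R) : Prop :=
  forall x (eps : R), 0 < eps -> exists2 delta : R, 0 < delta &
    forall y, d x y < delta -> `|u x - u y| < eps.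

End metric.

Local Open Scope ereal_scope.

Section mrws.
Context {R : realType} {dX : measure_display} {X : measurableType dX}.

Definition borel_of (d : X -> X -> R) : Prop :=
  @measurable _ X = <<s [set U | d_open d U] >>.

Definition metric_random_walk_space (d : X -> X -> R) (m : R.-pker X ~> X)
  : Prop :=
  [/\ polish_metric d, borel_of d &
      forall x : X, \int[m x]_y (d x y)%:E < +oo].

(** iterates m_x^{*n}; m_x^{*0} = delta_x,
    m_x^{*(n+1)}(A) = \int m_z(A) d m_x^{*n}(z) *)
Fixpoint mstar (m : R.-pker X ~> X) (n : nat) : R.-spker X ~> X :=
  match n with
  | 0 => kdirac (@measurable_id _ X setT)
  | n'.+1 => mkcomp_noparam (mstar m n') m
  end.

Definition invariant_measure (nu : {measure set X -> \bar R})
  (m : R.-pker X ~> X) : Prop :=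
  forall A : set X, measurable A -> nu A = \int[nu]_x (m x A).

Definition radon_measure (d : X -> X -> R) (nu : {measure set X -> \bar R})
  : Prop :=
  (forall x : X, exists2 r : R, (0 < r)%R & nu (d_ball d x r) < +oo) /\
  (forall A : set X, measurable A ->
     nu A = ereal_sup [set nu K | K in [set K | d_compact d K /\ K `<=` A]]).

Definition N_set (m : R.-pker X ~> X) (D : set X) : set X :=
  [set x | forall n : nat, (0 < n)%N -> mstar m n x D = 0].

Definition m_connected (nu : {measure set X -> \bar R}) (m : R.-pker X ~> X)
  : Prop :=
  forall D : set X, measurable D -> 0 < nu D -> nu D < +oo ->
    nu (N_set m D) = 0.

(** pointwise heat semigroup
    e^{t Delta_m} u0 (x) = e^{-t} \sum_n t^n/n! \int u0 d m_x^{*n} *)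
Definition heat_semigroup (m : R.-pker X ~> X) (u0 : X -> R) (t : R) (x : X)
  : \bar R :=
  (expR (- t))%:E *
  \sum_(0 <= n <oo) ((t ^+ n / (n`!)%:R)%:E * \int[mstar m n x]_y (u0 y)%:E).

Definition weakly_strong_m_connected (d : X -> X -> R)
  (nu : {measure set X -> \bar R}) (m : R.-pker X ~> X) : Prop :=
  forall u0 : X -> R,
    (forall x, (0 <= u0 x)%R) ->
    \int[nu]_x ((`|u0 x| ^+ 2)%:E) < +oo ->
    d_continuous d u0 ->
    ~ {ae nu, forall x, u0 x = 0%R} ->
    forall t : R, (0 < t)%R -> forall x : X, 0 < heat_semigroup m u0 t x.

Definition coupling (mu mu' : {measure set X -> \bar R})
  (gam : probability (X * X)%type R) : Prop :=
  forall A : set X, measurable A ->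
    gam (A `*` setT) = mu A /\ gam (setT `*` A) = mu' A.

Definition W1 (d : X -> X -> R) (mu mu' : {measure set X -> \bar R}) : \bar R :=
  ereal_inf [set \int[gam]_p (d p.1 p.2)%:E
            | gam in [set gam | coupling mu mu' gam]].

Definition ollivier_ricci (d : X -> X -> R) (m : R.-pker X ~> X) : \bar R :=
  ereal_inf [set r | exists x y : X, x <> y /\
                       r = 1 - W1 d (m x) (m y) * ((d x y)^-1)%:E].

End mrws.

(* Main.v *)
(** By the easy half of Kantorovich duality, curvature at least k > 0 makes
    averaging against m turn L-Lipschitz functions into (1 - k) L-Lipschitz
    ones, so the n-th averages P^n f of a bounded Lipschitz f flatten out.
    If mu is a finite invariant measure, integrating P^n f against mu does not
    change the integral of f, and dominated convergence gives
    P^n f(x) mu(X) -> \int f dmu for every x.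

    Strict positivity of the heat semigroup: if all integrals of u0 against
    m_x^{*n} vanish, apply this to a Lipschitz minorant f of u0 (the
    inf-convolution of min(u0, 1) with d), to get \int f dnu = 0 and u0 = 0 a.e.

    Connectedness: Lipschitz inf-convolutions approximate indicators of open
    sets, so finite invariant measures are proportional. The set N = N^m_D is
    absorbing, hence nu restricted to N is invariant; if nu(N) > 0, then
    nu(~N) = 0, and nu(D) = \int_N m_x(D) dnu = 0. *)

Require Import Defs.
From HB Require Import structures.
From mathcomp Require Import all_boot all_order all_algebra.
From mathcomp Require Import all_classical all_reals all_analysis.
From mathcomp Require Import measurable_realfun lra.
Set Implicit Arguments. Unset Strict Implicit. Unset Printing Implicit Defensive.
Import Order.TTheory GRing.Theory Num.Theory.
Import numFieldNormedType.Exports.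
Import HBNNSimple.
Local Open Scope classical_set_scope.
Local Open Scope ring_scope.
Local Open Scope ereal_scope.

(** * Integration: mixtures of measures, and comparison without measurability *)

(** For a simple function this is a finite sum over its values; monotone convergence along an
    increasing simple approximation then reaches f. It yields both the composition rule for iterates
    and the invariance of integrals. *)
Lemma integral_mixture (R : realType) d1 d2 (X : measurableType d1)
    (Y : measurableType d2) (l : {measure set X -> \bar R})
    (k : X -> {measure set Y -> \bar R}) (mu : {measure set Y -> \bar R}) :
  (forall U, measurable U -> measurable_fun [set: X] (k ^~ U)) ->
  (forall U, measurable U -> mu U = \int[l]_x k x U) ->
  forall f : Y -> \bar R, (forall y, 0 <= f y) -> measurable_fun [set: Y] f ->
  \int[mu]_y f y = \int[l]_x \int[k x]_y f y.
Proof.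
move=> mk muE f f0 mf.
pose g := nnsfun_approx measurableT mf.
have g_nd y : {homo (fun n => g n y) : n p / (n <= p)%N >-> (n <= p)%R}.
  by move=> n p np; exact/lefP/nd_nnsfun_approx.
have g_cvg y : EFin \o (g ^~ y) @ \oo --> f y.
  by apply: cvg_nnsfun_approx.
have mix (h : {nnsfun Y >-> R}) : sintegral mu h = \int[l]_x sintegral (k x) h.
  under eq_integral do rewrite sintegralE.
  rewrite ge0_integral_fsum//=; last 2 first.
  - by move=> r; apply: measurable_funeM; exact: mk.
  - by move=> r x _; have := mulemu_ge0 (mu := k x) (fun n => h @^-1` [set n]);
      apply => r0; exact: preimage_nnfun0.
  rewrite sintegralE; apply: eq_fsbigr => r _.
  (* A negative r is not a value of h, so its preimage is empty and both sides vanish. *)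
  have [r0|r0] := leP 0%R r.
    by rewrite ge0_integralZl ?muE//; exact: mk.
  rewrite preimage_nnfun0// measure0 mule0.
  by rewrite integral0_eq// => x _; rewrite measure0 mule0.
rewrite (nd_ge0_integral_lim _ f0 g_nd g_cvg).
rewrite (_ : _ \o _ = fun n => \int[l]_x sintegral (k x) (g n)); last first.
  by apply/funext => n /=; rewrite mix.
rewrite -monotone_convergence//.
- by apply: eq_integral => x _; rewrite (nd_ge0_integral_lim _ f0 g_nd g_cvg).
- move=> n; under eq_fun do rewrite -integralT_nnsfun.
  apply: measurable_fun_integral_kernel => //; last exact/measurable_EFinP.
  by move=> y; rewrite lee_fin.
- by move=> n x _; exact: sintegral_ge0.
- by move=> x _ n p np; apply: le_sintegral => y; exact: g_nd.
Qed.

(* The integral of a nonnegative function, measurable or not, is the supremum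
   of the integrals of the simple functions below it. *)
Lemma ge0_le_integral_nonmeasurable (R : realType) d1 (X : measurableType d1)
    (mu : {measure set X -> \bar R}) (f g : X -> \bar R) :
  (forall x, 0 <= f x) -> (forall x, f x <= g x) ->
  \int[mu]_x f x <= \int[mu]_x g x.
Proof.
move=> f0 fg; have g0 x : 0 <= g x by exact: le_trans (fg x).
rewrite !ge0_integralTE//; apply: le_ereal_sup => _ [h hf <-].
by exists h => // x; exact: le_trans (fg x).
Qed.

(** * Lipschitz functions, couplings and contraction of the Wasserstein distance *)

(** One-sided on purpose: for a symmetric d, exchanging x and y bounds the absolute value. *)
Definition lipschitz_wrt (R : realType) (X : Type) (d : X -> X -> R) (L : R)
  (f : X -> R) := forall x y, (f x - f y <= L * d x y)%R.

Definition unit_valued (R : realType) (X : Type) (f : X -> R) :=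
  forall x, (0 <= f x <= 1)%R.

Section metric_lemmas.
Context {R : realType} {dX : measure_display} {X : measurableType dX}.
Implicit Types (d : X -> X -> R) (f : X -> R) (L : R).

Lemma lipschitz_wrt_continuous d L f : is_metric d -> (0 < L)%R ->
  lipschitz_wrt d L f -> d_continuous d f.
Proof.
move=> [_ _ dC _] L0 fL x e e0; exists (e / L)%R; first exact: divr_gt0.
move=> y; rewrite ltr_pdivlMr// mulrC => xye.
apply: le_lt_trans xye; rewrite ler_norml.
have := fL x y; have := fL y x; rewrite (dC y x).
by move=> h1 h2; apply/andP; split; lra.
Qed.

Lemma d_continuous_measurable d f : borel_of d -> is_metric d ->
  d_continuous d f -> measurable_fun [set: X] f.
Proof.
move=> dB [_ _ dC _] cf.
apply: (measurability _ (RGenOInfty.measurableE R)).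
move=> _ [_ [a ->] <-]; rewrite setTI dB; apply: sub_sigma_algebra => x /=.
rewrite in_itv/= andbT => afx.
have [|e e0 he] := cf x (f x - a)%R; first by rewrite subr_gt0.
exists e => // y /he; rewrite ltr_norml/= in_itv/= andbT => /andP[_]; lra.
Qed.

Lemma lipschitz_wrt_measurable d L f : borel_of d -> is_metric d -> (0 < L)%R ->
  lipschitz_wrt d L f -> measurable_fun [set: X] f.
Proof.
move=> dB dM L0 fL.
exact: d_continuous_measurable (lipschitz_wrt_continuous dM L0 fL).
Qed.

Lemma unit_valued_integral_le (mu : {measure set X -> \bar R}) f :
  measurable_fun [set: X] f -> unit_valued f ->
  0 <= \int[mu]_x (f x)%:E <= mu setT.
Proof.
move=> mf f01; apply/andP; split.
  by apply: integral_ge0 => x _; rewrite lee_fin; case/andP: (f01 x).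
rewrite -[leRHS]mul1e -(integral_cst mu measurableT 1).
apply: ge0_le_integral_nonmeasurable => x; rewrite lee_fin;
  by case/andP: (f01 x).
Qed.

Lemma unit_valued_integral_fin_num (mu : {measure set X -> \bar R}) f :
  mu setT < +oo -> measurable_fun [set: X] f -> unit_valued f ->
  \int[mu]_x (f x)%:E \is a fin_num.
Proof.
move=> muT mf f01; have /andP[h0 h1] := unit_valued_integral_le mu mf f01.
by rewrite ge0_fin_numE//; exact: le_lt_trans muT.
Qed.

Lemma coupling_integral_fst (mu mu' : {measure set X -> \bar R})
    (gam : probability (X * X)%type R) f :
  coupling mu mu' gam -> measurable_fun [set: X] f -> (forall x, 0 <= f x)%R ->
  \int[gam]_p (f p.1)%:E = \int[mu]_x (f x)%:E.
Proof.
move=> cgam mf f0.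
rewrite (eq_measure_integral (pushforward gam fst)); last first.
  move=> A mA _; rewrite /pushforward -(cgam A mA).1.
  by congr (gam _); apply/seteqP; split => -[x y]//= [].
rewrite ge0_integral_pushforward//; first exact/measurable_EFinP.
by move=> x _; rewrite lee_fin.
Qed.

Lemma coupling_integral_snd (mu mu' : {measure set X -> \bar R})
    (gam : probability (X * X)%type R) f :
  coupling mu mu' gam -> measurable_fun [set: X] f -> (forall x, 0 <= f x)%R ->
  \int[gam]_p (f p.2)%:E = \int[mu']_x (f x)%:E.
Proof.
move=> cgam mf f0.
rewrite (eq_measure_integral (pushforward gam snd)); last first.
  move=> A mA _; rewrite /pushforward -(cgam A mA).2.
  by congr (gam _); apply/seteqP; split => -[x y]//= [].
rewrite ge0_integral_pushforward//; first exact/measurable_EFinP.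
by move=> x _; rewrite lee_fin.
Qed.

(* This is the easy half of Kantorovich duality. The positive part of
   (f p.1 - f p.2) / L is measurable and lies below d, whereas d itself is not
   assumed measurable for the product sigma-algebra. *)
Lemma lipschitz_wrt_W1 d L f (mu mu' : {measure set X -> \bar R}) :
  is_metric d -> mu setT < +oo -> mu' setT < +oo ->
  (0 < L)%R -> measurable_fun [set: X] f -> unit_valued f ->
  lipschitz_wrt d L f ->
  ((fine (\int[mu]_x (f x)%:E) - fine (\int[mu']_x (f x)%:E)) / L)%:E
    <= W1 d mu mu'.
Proof.
move=> [d0 _ _ _] muT mu'T L0 mf f01 fL.
have f0 x : (0 <= f x)%R by case/andP: (f01 x).
apply: le_ereal_inf_tmp => _ [gam cgam <-].
pose h (p : X * X) := Num.max 0%R ((f p.1 - f p.2) / L)%R.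
have mf1 : measurable_fun [set: X * X] (fun p : X * X => f p.1).
  exact: measurableT_comp mf measurable_fst.
have mf2 : measurable_fun [set: X * X] (fun p : X * X => f p.2).
  exact: measurableT_comp mf measurable_snd.
have mh : measurable_fun [set: X * X] h.
  apply: measurable_maxr => //; apply: measurable_funM => //.
  exact: measurable_funB.
have h0 p : (0 <= h p)%R by rewrite /h le_max lexx.
have hd : \int[gam]_p (h p)%:E <= \int[gam]_p (d p.1 p.2)%:E.
  apply: ge0_le_integral_nonmeasurable => p; rewrite lee_fin// /h ge_max d0/=.
  by rewrite ler_pdivrMr// mulrC.
apply: le_trans hd.
(* Pointwise f p.1 <= f p.2 + L h p. Keeping a sum on the right leaves only nonnegative integrands;
   the subtraction waits until both marginal integrals are known to be finite. *)
have fh : \int[mu]_x (f x)%:E <=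
    \int[mu']_x (f x)%:E + L%:E * \int[gam]_p (h p)%:E.
  rewrite -(coupling_integral_fst cgam)// -(coupling_integral_snd cgam)//.
  rewrite -ge0_integralZl//; last 3 first.
  - exact/measurable_EFinP.
  - by move=> p _; rewrite lee_fin.
  - by rewrite lee_fin ltW.
  rewrite -ge0_integralD//; last 4 first.
  - by move=> p _; rewrite lee_fin.
  - exact/measurable_EFinP.
  - by move=> p _; rewrite -EFinM lee_fin mulr_ge0// ltW.
  - by apply: measurable_funeM; exact/measurable_EFinP.
  apply: ge0_le_integral_nonmeasurable => p; first by rewrite lee_fin.
  rewrite -EFinM -EFinD lee_fin -lerBlDl mulrC -ler_pdivrMr// /h le_max lexx.
  by rewrite orbT.
have := unit_valued_integral_fin_num muT mf f01.
have := unit_valued_integral_fin_num mu'T mf f01.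
move: fh; case: (\int[mu]_x _) => // r; case: (\int[mu']_x _) => // s.
have : 0 <= \int[gam]_p (h p)%:E.
  by apply: integral_ge0 => p _; rewrite lee_fin.
case: (\int[gam]_p _) => [t||]//= t0; last by move=> *; rewrite leey.
rewrite -EFinM -EFinD !lee_fin => rst _ _.
by rewrite ler_pdivrMr// lerBlDl mulrC.
Qed.

End metric_lemmas.

Lemma ollivier_ricci_W1_contraction (R : realType) (dX : measure_display)
    (X : measurableType dX) (d : X -> X -> R) (m : R.-pker X ~> X) :
  is_metric d -> 0 < ollivier_ricci d m ->
  exists q : R, [/\ (0 < q)%R, (q < 1)%R &
    forall x y, x <> y -> W1 d (m x) (m y) <= (q * d x y)%:E].
Proof.
move=> [d0 dE _ _] kappa0.
have [k [k0 k1 kle]] : exists k : R,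
    [/\ (0 < k)%R, (k < 1)%R & k%:E <= ollivier_ricci d m].
  (* Cutting k at 1/2 keeps q = 1 - k positive, so the Lipschitz constants q^n L stay positive
     later. The value +oo is the infimum of the empty set, when X has no two distinct points. *)
  move: kappa0; case: (ollivier_ricci d m) => [r|_|//].
    rewrite lte_fin => r0; exists (Num.min r 2^-1)%R; split.
    - by rewrite lt_min r0 invr_gt0 ltr0n.
    - by rewrite gt_min invf_lt1 ?ltr0n// ltr1n orbT.
    - by rewrite lee_fin ge_min lexx.
  by exists (2^-1)%R; split; rewrite ?leey ?invr_gt0 ?invf_lt1 ?ltr0n ?ltr1n.
exists (1 - k)%R; split; [lra|lra|move=> x y xy].
have dxy : (0 < d x y)%R.
  by rewrite lt_neqAle d0 andbT eq_sym; apply/eqP => /dE.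
have : k%:E <= 1 - W1 d (m x) (m y) * ((d x y)^-1)%:E.
  by apply: le_trans kle _; apply: ereal_inf_lbound; exists x, y.
have : 0 <= W1 d (m x) (m y).
  apply: le_ereal_inf_tmp => _ [gam _ <-].
  by apply: integral_ge0 => p _; rewrite lee_fin.
(* An infinite W1 would turn the curvature bound into k <= -oo. *)
case: (W1 _ _ _) => [w _||//]; last by rewrite gt0_mulye ?lte_fin ?invr_gt0.
rewrite -EFinM -EFinB !lee_fin -(ler_pM2r dxy) mulrBl mulfVK ?gt_eqF//.
lra.
Qed.

(** * Iterated kernels and the flattening of averages *)

Section iterates.
Context {R : realType} {dX : measure_display} {X : measurableType dX}.
Context (m : R.-pker X ~> X).
Implicit Types (d : X -> X -> R) (f : X -> R) (g : X -> \bar R).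

Lemma integral_mstar0 g x : measurable_fun [set: X] g ->
  \int[mstar m 0 x]_y g y = g x.
Proof. by move=> mg; rewrite integral_dirac// diracT mul1e. Qed.

Lemma measurable_integral_mstar n g : (forall x, 0 <= g x) ->
  measurable_fun [set: X] g ->
  measurable_fun [set: X] (fun x => \int[mstar m n x]_y g y).
Proof.
move=> g0 mg; apply: measurable_fun_integral_kernel => // U mU.
exact: measurable_kernel.
Qed.

Lemma integral_mstarSr n g x : (forall x, 0 <= g x) ->
  measurable_fun [set: X] g ->
  \int[mstar m n.+1 x]_y g y = \int[mstar m n x]_z \int[m z]_y g y.
Proof.
by move=> g0 mg; apply: integral_mixture => // U mU; exact: measurable_kernel.
Qed.

Lemma measurable_integral_kernel g : (forall x, 0 <= g x) ->
  measurable_fun [set: X] g ->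
  measurable_fun [set: X] (fun x => \int[m x]_y g y).
Proof.
move=> g0 mg; apply: measurable_fun_integral_kernel => // U mU.
exact: measurable_kernel.
Qed.

(** [mstar] appends its new step at the end of the walk; here the first step is split off instead,
    as the absorbing property of [N_set] requires. The induction replaces g by its average under
    m. *)
Lemma integral_mstarSl n g x : (forall x, 0 <= g x) ->
  measurable_fun [set: X] g ->
  \int[mstar m n.+1 x]_y g y = \int[m x]_z \int[mstar m n z]_y g y.
Proof.
elim: n g => [|n IH] g g0 mg.
  rewrite integral_mstarSr// integral_mstar0; last first.
    exact: measurable_integral_kernel.
  by apply: eq_integral => z _; rewrite integral_mstar0.
rewrite integral_mstarSr// IH.
- by apply: eq_integral => z _; rewrite integral_mstarSr.
- by move=> z; exact: integral_ge0.
- exact: measurable_integral_kernel.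
Qed.

Lemma invariant_integral_mstar (mu : {measure set X -> \bar R}) n g :
  invariant_measure mu m -> (forall x, 0 <= g x) -> measurable_fun [set: X] g ->
  \int[mu]_x \int[mstar m n x]_y g y = \int[mu]_x g x.
Proof.
move=> muP; elim: n g => [|n IH] g g0 mg.
  by apply: eq_integral => x _; rewrite integral_mstar0.
under eq_integral do rewrite integral_mstarSr//.
rewrite IH.
- by apply/esym/integral_mixture => // U mU; exact: measurable_kernel.
- by move=> z; exact: integral_ge0.
- exact: measurable_integral_kernel.
Qed.

(** This is P^n f as a real function; [fine] loses nothing for measurable f with values in [0,1]. *)
Definition mean_mstar n f x : R := fine (\int[mstar m n x]_y (f y)%:E).

Lemma mean_mstarE n f x : measurable_fun [set: X] f -> unit_valued f ->
  (mean_mstar n f x)%:E = \int[mstar m n x]_y (f y)%:E.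
Proof.
move=> mf f01; rewrite fineK// unit_valued_integral_fin_num//.
by apply: le_lt_trans (sprob_kernel_le1 (mstar m n) x) _; rewrite ltry.
Qed.

Lemma mean_mstar_unit_valued n f : measurable_fun [set: X] f ->
  unit_valued f -> unit_valued (mean_mstar n f).
Proof.
move=> mf f01 x; rewrite -!lee_fin mean_mstarE//.
have /andP[-> h] := unit_valued_integral_le (mstar m n x) mf f01.
by apply: le_trans h _; exact: sprob_kernel_le1.
Qed.

Lemma measurable_mean_mstar n f : measurable_fun [set: X] f ->
  unit_valued f -> measurable_fun [set: X] (mean_mstar n f).
Proof.
move=> mf f01; apply/measurable_EFinP.
rewrite (_ : _ \o _ = fun x => \int[mstar m n x]_y (f y)%:E).
  apply: measurable_integral_mstar; last exact/measurable_EFinP.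
  by move=> x; rewrite lee_fin; case/andP: (f01 x).
by apply/funext => x /=; rewrite mean_mstarE.
Qed.

Lemma mean_mstarS n f x : measurable_fun [set: X] f -> unit_valued f ->
  mean_mstar n.+1 f x = mean_mstar n (mean_mstar 1 f) x.
Proof.
move=> mf f01; rewrite /mean_mstar integral_mstarSr//; last 2 first.
  by move=> y; rewrite lee_fin; case/andP: (f01 y).
  exact/measurable_EFinP.
congr fine; apply: eq_integral => z _; rewrite -/(mean_mstar 1 f z) mean_mstarE//.
rewrite integral_mstarSl ?integral_mstar0//.
- by apply: eq_integral => y _; rewrite integral_mstar0//; exact/measurable_EFinP.
- by move=> y; rewrite lee_fin; case/andP: (f01 y).
- exact/measurable_EFinP.
Qed.

(** One step multiplies the Lipschitz constant by q, by [lipschitz_wrt_W1] and the contraction of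
    W1. The induction peels off the step next to f, so f and L must vary: P^(n+1) f = P^n (P f),
    where P f has constant q L. *)
Lemma mean_mstar_lipschitz d (q L : R) n f : is_metric d -> borel_of d ->
  (0 < q)%R -> (forall x y, x <> y -> W1 d (m x) (m y) <= (q * d x y)%:E) ->
  (0 < L)%R -> unit_valued f -> lipschitz_wrt d L f ->
  lipschitz_wrt d (q ^+ n * L) (mean_mstar n f).
Proof.
move=> dM dB q0 Wq; have [d0 dE _ _] := dM.
elim: n L f => [|n IH] L f L0 f01 fL.
  have mf := lipschitz_wrt_measurable dB dM L0 fL.
  by move=> x y; rewrite expr0 mul1r /mean_mstar !integral_mstar0//;
    [exact: fL|exact/measurable_EFinP..].
have mf := lipschitz_wrt_measurable dB dM L0 fL.
move=> x y; rewrite !mean_mstarS// exprSr -(mulrA (q ^+ n)%R).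
apply: IH; [exact: mulr_gt0|exact: mean_mstar_unit_valued|].
move=> {}x {}y; have [->|/eqP xy] := eqVneq x y.
  by rewrite subrr mulr_ge0// ltW// mulr_gt0.
have mean1 z : mean_mstar 1 f z = fine (\int[m z]_y (f y)%:E).
  rewrite /mean_mstar integral_mstarSl//.
  - congr fine; apply: eq_integral => w _.
    by rewrite integral_mstar0//; exact/measurable_EFinP.
  - by move=> w; rewrite lee_fin; case/andP: (f01 w).
  - exact/measurable_EFinP.
rewrite !mean1 -mulrA mulrCA -ler_pdivrMl// mulrC -lee_fin.
apply: le_trans (Wq _ _ xy); apply: lipschitz_wrt_W1 => //.
  by rewrite prob_kernel ltry.
by rewrite prob_kernel ltry.
Qed.

(** P^n f - P^n f(x0) is bounded by 1 and pointwise by q^n L d(x, x0), so its integral tends to 0.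
    The limit is multiplied by mu(X) instead of divided by it, so that the zero measure is
    covered. *)
Lemma mean_mstar_cvg d (q L : R) f (mu : {measure set X -> \bar R}) x0 :
  is_metric d -> borel_of d -> (0 < q)%R -> (q < 1)%R ->
  (forall x y, x <> y -> W1 d (m x) (m y) <= (q * d x y)%:E) ->
  (0 < L)%R -> unit_valued f -> lipschitz_wrt d L f ->
  mu setT < +oo -> invariant_measure mu m ->
  (mean_mstar n f x0 * fine (mu setT))%R @[n --> \oo] -->
    fine (\int[mu]_x (f x)%:E).
Proof.
move=> dM dB q0 q1 Wq L0 f01 fL muT muP.
have mf := lipschitz_wrt_measurable dB dM L0 fL.
pose F n x := mean_mstar n f x.
have mF n : measurable_fun [set: X] (F n) by exact: measurable_mean_mstar.
have F01 n : unit_valued (F n) by exact: mean_mstar_unit_valued.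
have FL n : lipschitz_wrt d (q ^+ n * L) (F n) by exact: mean_mstar_lipschitz.
have cst_int (c : R) : mu.-integrable [set: X] (cst c%:E).
  apply/integrableP; split => //.
  rewrite integral_cst//= -ge0_fin_numE ?mule_ge0// fin_numM//.
  by rewrite ge0_fin_numE.
have F_int n : mu.-integrable [set: X] (EFin \o F n).
  apply: (le_integrable measurableT _ _ (cst_int 1%R)).
    exact/measurable_EFinP.
  move=> x _ /=; rewrite lee_fin normr1.
  by case/andP: (F01 n x) => ? ?; rewrite ger0_norm.
have dom : (\int[mu]_x (F n x - F n x0)%:E) @[n --> \oo] --> 0.
  rewrite -(integral0 mu [set: X]).
  have [] // := @dominated_convergence _ X R mu setT measurableT
    (fun n x => (F n x - F n x0)%:E) (cst 0) (cst 1).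
  - by move=> n; apply/measurable_EFinP; exact: measurable_funB.
  - apply: aeW => x _ /=; apply: cvg_EFin; first exact: nearW.
    rewrite (_ : _ \o _ = fun n => F n x - F n x0)%R//.
    apply/cvgr0Pnorm_le => e e0.
    have : (geometric (L * d x x0)%R q) @ \oo --> (0 : R)%R.
      by apply: cvg_geometric; rewrite gtr0_norm.
    move=> /cvgr0Pnorm_le/(_ e e0); apply: filterS => n.
    have [d0 _ dC _] := dM.
    rewrite /geometric /= ger0_norm; last first.
      by rewrite mulr_ge0 ?exprn_ge0 ?mulr_ge0// ltW.
    apply: le_trans; have := FL n x x0; have := FL n x0 x; rewrite (dC x0 x).
    by rewrite mulrAC mulrC mulrA => h1 h2; rewrite ler_norml; apply/andP; split; lra.
  - apply: aeW => x n _ /=; rewrite lee_fin.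
    have /andP[a1 a2] := F01 n x; have /andP[b1 b2] := F01 n x0.
    by rewrite ler_norml; apply/andP; split; lra.
(* By invariance the integral of P^n f does not depend on n, so only P^n f(x0) still moves. *)
have FE n : \int[mu]_x (F n x - F n x0)%:E =
    (fine (\int[mu]_x (f x)%:E) - F n x0 * fine (mu setT))%:E.
  rewrite (integralB_EFin measurableT (F_int n) (cst_int (F n x0))).
  have muTfin : mu setT \is a fin_num by rewrite ge0_fin_numE.
  rewrite integral_cst//= EFinB EFinM (fineK muTfin).
  rewrite (fineK (unit_valued_integral_fin_num muT mf f01)); congr (_ - _).
  transitivity (\int[mu]_x \int[mstar m n x]_y (f y)%:E).
    by apply: eq_integral => x _; rewrite -mean_mstarE.
  apply: (@invariant_integral_mstar mu n (EFin \o f)) => //.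
    by move=> x; rewrite lee_fin; case/andP: (f01 x).
  exact/measurable_EFinP.
move: dom; rewrite (eq_cvg _ _ FE).
move=> /fine_cvgP[_].
rewrite (_ : fine \o _ =
  fun n => fine (\int[mu]_x (f x)%:E) - F n x0 * fine (mu setT))%R//= => /cvgN.
move=> /(cvgD (cvg_cst (fine (\int[mu]_x (f x)%:E)))).
by rewrite oppr0 addr0; apply: cvg_trans; apply: near_eq_cvg; apply: nearW => n /=;
  rewrite opprB addrC subrK.
Qed.

End iterates.

(** * Restricted measures and Lipschitz inf-convolutions *)

Lemma integral_mrestr (R : realType) (dX : measure_display)
    (X : measurableType dX) (mu : {measure set X -> \bar R}) (N : set X)
    (mN : measurable N) (g : X -> \bar R) :
  (forall x, 0 <= g x) -> measurable_fun [set: X] g ->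
  \int[mrestr mu mN]_x g x = \int[mu]_(x in N) g x.
Proof.
move=> g0 mg.
have mCN := measurableC mN.
rewrite -(setUv N) ge0_integral_setU//; last 2 first.
  by rewrite setUv.
  by apply/disj_setPS => x [].
rewrite [X in _ + X]null_set_integral//; last 2 first.
  exact: measurable_funS mg.
  by rewrite /= /mrestr setICl measure0.
rewrite adde0; apply: eq_measure_integral => A mA AN.
by rewrite /= /mrestr setIidl.
Qed.

Section inf_convolution.
Context {R : realType} {X : Type} (d : X -> X -> R).
Context (dM : is_metric d).
Implicit Types (u : X -> R) (L : R).

(** For u >= 0 and L > 0 this is the Pasch-Hausdorff envelope, the largest L-Lipschitz function
    below u. *)
Definition inf_conv L u x : R := inf (range (fun y => u y + L * d x y)%R).

Lemma inf_conv_le_shift L u x y : (0 < L)%R -> (forall z, 0 <= u z)%R ->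
  (inf_conv L u x <= u y + L * d x y)%R.
Proof.
have [d0 _ _ _] := dM => L0 u0; apply: ge_inf; last by exists y.
by exists 0%R => _ [z _ <-]; rewrite addr_ge0// mulr_ge0// ltW.
Qed.

Lemma inf_conv_ge L u x (c : R) :
  (forall y, c <= u y + L * d x y)%R -> (c <= inf_conv L u x)%R.
Proof.
move=> h; apply: lb_le_inf; first by exists (u x + L * d x x)%R, x.
by move=> _ [y _ <-].
Qed.

Lemma inf_conv_le L u x : (0 < L)%R -> (forall z, 0 <= u z)%R ->
  (inf_conv L u x <= u x)%R.
Proof.
have [_ dE _ _] := dM => L0 u0; have := inf_conv_le_shift x x L0 u0.
by rewrite (dE x x).2// mulr0 addr0.
Qed.

Lemma inf_conv_unit_valued L u : (0 < L)%R ->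
  unit_valued u -> unit_valued (inf_conv L u).
Proof.
have [d0 _ _ _] := dM => L0 u01 x.
have u0 z : (0 <= u z)%R by case/andP: (u01 z).
apply/andP; split.
  by apply: inf_conv_ge => y; rewrite addr_ge0// mulr_ge0// ltW.
by apply: le_trans (inf_conv_le x L0 u0) _; case/andP: (u01 x).
Qed.

Lemma inf_conv_lipschitz L u : (0 < L)%R -> (forall z, 0 <= u z)%R ->
  lipschitz_wrt d L (inf_conv L u).
Proof.
have [_ _ _ dT] := dM => L0 u0 x y; rewrite lerBlDl -lerBlDr.
apply: inf_conv_ge => z; rewrite lerBlDr.
apply: le_trans (inf_conv_le_shift x z L0 u0) _.
by rewrite -addrA lerD2l -mulrDr ler_pM2l// addrC.
Qed.

(** A competitor y in the ball costs at least c through u, one outside at least L r through the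
    distance. *)
Lemma inf_conv_ge_min L u x (c r : R) : (0 < L)%R -> (forall z, 0 <= u z)%R ->
  (forall y, d x y < r -> c <= u y)%R ->
  (Num.min c (L * r) <= inf_conv L u x)%R.
Proof.
have [d0 _ _ _] := dM => L0 u0 h; apply: inf_conv_ge => y; rewrite ge_min.
have [/h cu|rd] := ltP (d x y) r.
  by rewrite (le_trans cu)// lerDl mulr_ge0// ltW.
by rewrite [X in _ || X](_ : _ = true) ?orbT// -[leLHS]add0r lerD// ler_pM2l.
Qed.

End inf_convolution.

(** * Uniqueness of finite invariant measures up to scaling *)

Section invariant.
Context {R : realType} {dX : measure_display} {X : measurableType dX}.
Context (d : X -> X -> R) (m : R.-pker X ~> X).
Context (dM : is_metric d) (dB : borel_of d).
Context (kappa0 : 0 < ollivier_ricci d m).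

Lemma d_open_measurable (U : set X) : d_open d U -> measurable U.
Proof. by move=> oU; rewrite dB; exact: sub_sigma_algebra. Qed.

Lemma indic_unit_valued (U : set X) : unit_valued (\1_U : X -> R).
Proof. by move=> x; rewrite indicE; case: (x \in U); rewrite ?lexx ler01. Qed.

(** Outside U the envelope is 0. At a point of U whose r-ball lies in U it equals 1 as soon as (n+1)
    r >= 1. Dominated convergence with bound 1 concludes. *)
Lemma inf_conv_indic_cvg (mu : {measure set X -> \bar R}) (U : set X) :
  mu setT < +oo -> d_open d U ->
  fine (\int[mu]_x (inf_conv d n.+1%:R (\1_U) x)%:E) @[n --> \oo]
    --> fine (mu U).
Proof.
move=> muT oU; have mU := d_open_measurable oU.
have U01 : unit_valued (\1_U : X -> R) by exact: indic_unit_valued.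
have U0 x : (0 <= (\1_U x : R))%R by case/andP: (U01 x).
have L0 n : (0 < n.+1%:R :> R)%R by rewrite ltr0n.
have f01 n := inf_conv_unit_valued dM (L0 n) U01.
have muUfin : mu U \is a fin_num.
  by rewrite ge0_fin_numE//; apply: le_lt_trans muT; rewrite le_measure ?inE.
have muUE : \int[mu]_x (\1_U x)%:E = mu U by rewrite integral_indic// setIT.
apply: fine_cvg; rewrite fineK// -muUE.
have [] // := @dominated_convergence _ X R mu setT measurableT
  (fun n x => (inf_conv d n.+1%:R \1_U x)%:E) (fun x => (\1_U x)%:E) (cst 1).
- move=> n; apply/measurable_EFinP.
  exact: lipschitz_wrt_measurable (inf_conv_lipschitz dM (L0 n) U0).
- exact/measurable_EFinP.
- apply: aeW => x _; apply: cvg_EFin; first exact: nearW.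
  have [xU|xU] := pselect (U x); last first.
    rewrite indicE memNset//; apply: cvg_near_cst; apply: nearW => n /=.
    apply/eqP; rewrite eq_le; case/andP: (f01 n x) => -> _; rewrite andbT.
    by have := inf_conv_le dM x (L0 n) U0; rewrite indicE memNset.
  have [r r0 xr] := oU x xU.
  rewrite indicE mem_set//; apply: cvg_near_cst.
  near=> n; apply/eqP => /=; rewrite eq_le; case/andP: (f01 n x) => _ -> /=.
  have := @inf_conv_ge_min R X d dM n.+1%:R \1_U x 1%R r (L0 n) U0.
  rewrite (min_idPl _); first by apply => y /xr yU; rewrite indicE mem_set.
  rewrite -ler_pdivrMl// mulr1 ltW//.
  by near: n; exact: (near_infty_natSinv_lt (PosNum r0)).
- apply/integrableP; split => //.
  by rewrite integral_cst// normr1 mul1e.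
- by apply: aeW => x n _ /=; rewrite lee_fin ger0_norm; case/andP: (f01 n x).
Unshelve. all: by end_near. Qed.

(** The equality passes from Lipschitz functions to open sets by inf-convolution, then to all
    measurable sets because open sets form a generating pi-system. The cross-multiplied form allows
    null measures. *)
Lemma invariant_measure_proportional (mu nu : {measure set X -> \bar R})
    (x0 : X) (A : set X) :
  mu setT < +oo -> nu setT < +oo ->
  invariant_measure mu m -> invariant_measure nu m -> measurable A ->
  mu A * nu setT = nu A * mu setT.
Proof.
move=> muT nuT muP nuP mA.
have [q [q0 q1 Wq]] := ollivier_ricci_W1_contraction dM kappa0.
have muTfin : mu setT \is a fin_num by rewrite ge0_fin_numE.
have nuTfin : nu setT \is a fin_num by rewrite ge0_fin_numE.
have mu_fin B : measurable B -> mu B \is a fin_num.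
  by move=> mB; rewrite ge0_fin_numE//; apply: le_lt_trans muT;
    rewrite le_measure ?inE.
have nu_fin B : measurable B -> nu B \is a fin_num.
  by move=> mB; rewrite ge0_fin_numE//; apply: le_lt_trans nuT;
    rewrite le_measure ?inE.
(* The single sequence P^n f(x0) mu(X) nu(X) converges to both sides. *)
have lip_eq L f : (0 < L)%R -> unit_valued f -> lipschitz_wrt d L f ->
    (fine (\int[mu]_x (f x)%:E) * fine (nu setT) =
     fine (\int[nu]_x (f x)%:E) * fine (mu setT))%R.
  move=> L0 f01 fL.
  have h1 := cvgM (mean_mstar_cvg x0 dM dB q0 q1 Wq L0 f01 fL muT muP)
    (cvg_cst (fine (nu setT))).
  have h2 := cvgM (mean_mstar_cvg x0 dM dB q0 q1 Wq L0 f01 fL nuT nuP)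
    (cvg_cst (fine (mu setT))).
  rewrite -(cvg_lim (@Rhausdorff R) (h1 _ _)) -(cvg_lim (@Rhausdorff R) (h2 _ _)).
  by apply: (congr1 (fun u : nat -> R => limn u)); apply/funext => n /=; exact: mulrAC.
have open_eq U : d_open d U -> mu U * nu setT = nu U * mu setT.
  move=> oU; have mU := d_open_measurable oU.
  rewrite -(fineK (mu_fin _ mU)) -(fineK (nu_fin _ mU)).
  rewrite -(fineK muTfin) -(fineK nuTfin) -!EFinM; congr EFin.
  have h1 := cvgM (inf_conv_indic_cvg muT oU) (cvg_cst (fine (nu setT))).
  have h2 := cvgM (inf_conv_indic_cvg nuT oU) (cvg_cst (fine (mu setT))).
  rewrite -(cvg_lim (@Rhausdorff R) (h1 _ _)) -(cvg_lim (@Rhausdorff R) (h2 _ _)).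
  apply: (congr1 (fun u : nat -> R => limn u)); apply/funext => n; apply: (lip_eq n.+1%:R) => //.
    by apply: inf_conv_unit_valued => //; exact: indic_unit_valued.
  by apply: inf_conv_lipschitz => // x; case/andP: (indic_unit_valued U x).
(* Scaling each measure by the total mass of the other gives two finite measures that agree on open
   sets. *)
pose a := NngNum (fine_ge0 (measure_ge0 nu setT)).
pose b := NngNum (fine_ge0 (measure_ge0 mu setT)).
have openT : d_open d setT by move=> x _; exists 1%R.
suff : mscale a mu A = mscale b nu A.
  by rewrite /mscale /= !fineK// (muleC (nu setT)) (muleC (mu setT)).
apply: (@g_sigma_algebra_measure_unique _ R X [set U | d_open d U] _
  (fun=> setT)).
- exact: d_open_measurable.
- by move=> _; exact: openT.
- by rewrite bigcup_const//; exists 0%N.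
- move=> U V oU oV x [Ux Vx].
  have [r r0 rU] := oU x Ux; have [s s0 sV] := oV x Vx.
  exists (Num.min r s); first by rewrite lt_min r0.
  by move=> y; rewrite /d_ball /= lt_min => /andP[yr ys]; split;
    [exact: rU|exact: sV].
- move=> U /open_eq; rewrite /= /mscale /= !fineK// (muleC (nu setT)).
  by rewrite (muleC (mu setT)).
- by move=> _; rewrite /= /mscale /= fineK// -ge0_fin_numE ?mule_ge0// fin_numM.
- by rewrite -dB.
Qed.

End invariant.

(** * The points from which the walk never charges D *)

Section N_set.
Context {R : realType} {dX : measure_display} {X : measurableType dX}.
Context (m : R.-pker X ~> X) (D : set X).
Context (mD : measurable D).

Lemma measurable_N_set : measurable (N_set m D).
Proof.
rewrite (_ : N_set m D = \bigcap_n ((mstar m n.+1 ^~ D) @^-1` [set 0])).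
  apply: bigcapT_measurable => n; rewrite -[X in measurable X]setTI.
  exact: (measurable_kernel (mstar m n.+1) D mD measurableT [set 0]).
by apply/seteqP; split => x Nx; [move=> n _; exact: Nx|case=> // n _; exact: Nx].
Qed.

(** For x in the set, 0 = m_x^{*(n+2)}(D) is the m_x-integral of m_z^{*(n+1)}(D), which therefore
    vanishes for m_x-almost every z, simultaneously for the countably many n. *)
Lemma N_set_absorbing x : N_set m D x -> m x (~` N_set m D) = 0.
Proof.
move=> Nx; apply/negligibleP; first exact: measurableC measurable_N_set.
suff : {ae m x, forall z (n : nat), mstar m n.+1 z D = 0}.
  apply: negligibleS => z /= Nz h; apply: Nz => -[//|n] _; exact: h.
apply: ae_foralln => n.
have D0 z : 0 <= (\1_D z : R)%:E by rewrite lee_fin indicE.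
have mD1 : measurable_fun [set: X] (fun z => (\1_D z : R)%:E).
  exact/measurable_EFinP.
have h : \int[m x]_z mstar m n.+1 z D = 0.
  rewrite -(Nx n.+2)// -[in RHS](setIT D) -integral_indic//.
  rewrite integral_mstarSl//; apply: eq_integral => z _.
  by rewrite integral_indic// setIT.
have /ae_eq_integral_abs : measurable_fun [set: X] (mstar m n.+1 ^~ D).
  exact: measurable_kernel.
move=> /(_ (m x) measurableT)[+ _]; under eq_integral do rewrite gee0_abs//.
by move=> /(_ h); apply: filterS => z /(_ I).
Qed.

End N_set.

(** * Absorbing sets, connectedness and positivity of the heat semigroup *)

Section positive_curvature.
Context {R : realType} {dX : measure_display} {X : measurableType dX}.
Context (d : X -> X -> R) (m : R.-pker X ~> X) (nu : {measure set X -> \bar R}).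
Context (dM : is_metric d) (dB : borel_of d).
Context (nuP : invariant_measure nu m) (nuT : nu setT < +oo).
Context (kappa0 : 0 < ollivier_ricci d m).

(** No mass leaves N by assumption. By invariance and finiteness of nu, none enters it from outside
    either, so the walk preserves the part of nu on N. *)
Lemma mrestr_absorbing_invariant (N : set X) (mN : measurable N) :
  (forall x, N x -> m x (~` N) = 0) -> invariant_measure (mrestr nu mN) m.
Proof.
move=> N0 A mA.
have mCN := measurableC mN.
have mker B : measurable B -> measurable_fun [set: X] (m ^~ B).
  by move=> mB; exact: measurable_kernel.
have split B : measurable B ->
    nu B = \int[nu]_(x in N) m x B + \int[nu]_(x in ~` N) m x B.
  move=> mB; rewrite nuP// -ge0_integral_setU ?setUv//; first exact: mker.
  by apply/disj_setPS => x [].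
have mI x B : N x -> measurable B -> m x (B `&` N) = m x B.
  move=> Nx mB; rewrite [RHS](measureDI _ mB mN).
  rewrite [X in X + _](_ : _ = 0) ?add0e//.
  apply/eqP; rewrite -measure_le0 -(N0 x Nx) le_measure// ?inE//.
  exact: measurableD.
have nuNfin : nu N \is a fin_num.
  by rewrite ge0_fin_numE//; apply: le_lt_trans nuT; rewrite le_measure ?inE.
(* Invariance at N reads nu(N) = nu(N) + (inflow from outside); the finite nu(N) cancels. *)
have out0 : \int[nu]_(x in ~` N) m x N = 0.
  have := split _ mN.
  rewrite (_ : \int[nu]_(x in N) m x N = nu N); last first.
    rewrite -[RHS]mul1e -integral_cst//; apply: eq_integral => x.
    rewrite inE => Nx.
    by rewrite -[N in m x N]setTI mI// prob_kernel.
  have : 0 <= \int[nu]_(x in ~` N) m x N by exact: integral_ge0.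
  move: nuNfin; case: (nu N) => // r _.
  case: (\int[nu]_(x in ~` N) m x N) => //= s _ [] rs.
  by congr EFin; lra.
rewrite integral_mrestr//; last exact: mker.
rewrite /= /mrestr (split _ (measurableI _ _ mA mN)).
rewrite [X in _ + X](_ : _ = 0); last first.
  apply/eqP; rewrite eq_le integral_ge0// andbT -[leRHS]out0.
  apply: ge0_le_integral => //.
  - by apply: measurable_funTS; apply: mker; exact: measurableI.
  - by apply: measurable_funTS; exact: mker.
  - by move=> x _; rewrite le_measure ?inE//; exact: measurableI.
by rewrite adde0; apply: eq_integral => x; rewrite inE => Nx; rewrite mI.
Qed.

Lemma positive_curvature_m_connected : m_connected nu m.
Proof.
move=> D mD D0 _.
have mN : measurable (N_set m D) by exact: measurable_N_set.
have mCN := measurableC mN.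
have NP := mrestr_absorbing_invariant mN (N_set_absorbing mD).
have nufin B : measurable B -> nu B \is a fin_num.
  by move=> mB; rewrite ge0_fin_numE//; apply: le_lt_trans nuT;
    rewrite le_measure ?inE.
have [x0 _] : D !=set0.
  by apply/set0P/eqP => DE; move: D0; rewrite DE measure0 ltxx.
have restrT : mrestr nu mN setT < +oo.
  by rewrite /mrestr setTI -ge0_fin_numE ?nufin.
(* Taken at the complement of N, where the restriction vanishes, proportionality says nu(~N) nu(N) =
   0. *)
have := invariant_measure_proportional dM dB kappa0 x0 restrT nuT NP nuP mCN.
rewrite /= /mrestr setICl setTI measure0 mul0e => /esym/eqP.
rewrite mule_eq0 => /orP[/eqP CN0|/eqP//].
suff DE : nu D = 0 by move: D0; rewrite DE ltxx.
rewrite nuP// -(setUv (N_set m D)) ge0_integral_setU//; last 2 first.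
- by rewrite setUv; exact: measurable_kernel.
- by apply/disj_setPS => x [].
rewrite [X in _ + X]null_set_integral//; last first.
  by apply: measurable_funTS; exact: measurable_kernel.
rewrite adde0 integral0_eq// => x Nx.
rewrite -(Nx 1%N isT); apply/esym.
by apply: (integral_mstar0 m (g := m ^~ D)); exact: measurable_kernel.
Qed.

Lemma exists_integral_mstar_gt0 (u : X -> R) x :
  (forall y, 0 <= u y)%R -> d_continuous d u ->
  ~ {ae nu, forall y, u y = 0%R} ->
  exists n, 0 < \int[mstar m n x]_y (u y)%:E.
Proof.
move=> u0 cu uN0; apply: contrapT => /forallNP h.
have int0 n : \int[mstar m n x]_y (u y)%:E = 0.
  apply/eqP; rewrite eq_le integral_ge0 ?andbT; last first.
    by move=> y _; rewrite lee_fin.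
  by rewrite leNgt; apply/negP; exact: h.
have [q [q0 q1 Wq]] := ollivier_ricci_W1_contraction dM kappa0.
(* Truncation at 1 puts the minorant f within reach of [mean_mstar_cvg], which wants values in
   [0,1]. *)
pose v y := Num.min (u y) 1%R.
have v01 : unit_valued v.
  by move=> y; rewrite /v le_min u0 ler01 ge_min lexx orbT.
have v0 y : (0 <= v y)%R by case/andP: (v01 y).
pose f := inf_conv d 1 v.
have f01 : unit_valued f by exact: inf_conv_unit_valued.
have f0 y : (0 <= f y)%R by case/andP: (f01 y).
have fL : lipschitz_wrt d 1 f by exact: inf_conv_lipschitz.
have mf := lipschitz_wrt_measurable dB dM ltr01 fL.
have fu y : (f y <= u y)%R.
  by apply: le_trans (inf_conv_le dM y ltr01 v0) _; rewrite /v ge_min lexx.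
have mean0 n : mean_mstar m n f x = 0%R.
  rewrite /mean_mstar (_ : integral _ _ _ = 0)//.
  apply/eqP; rewrite eq_le integral_ge0 ?andbT; last first.
    by move=> y _; rewrite lee_fin.
  rewrite -(int0 n); apply: ge0_le_integral_nonmeasurable => y;
    by rewrite lee_fin.
have := mean_mstar_cvg x dM dB q0 q1 Wq ltr01 f01 fL nuT nuP.
rewrite (_ : (fun n => _) = cst 0%R); last first.
  by apply/funext => n; rewrite mean0 mul0r.
move=> /(cvg_lim (@Rhausdorff R)); rewrite lim_cst; last exact: Rhausdorff.
move=> fine_int_f.
have int_f : \int[nu]_y (f y)%:E = 0.
  by rewrite -[LHS]fineK ?unit_valued_integral_fin_num// -fine_int_f.
apply: uN0.
have /ae_eq_integral_abs : measurable_fun [set: X] (EFin \o f).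
  exact/measurable_EFinP.
move=> /(_ nu measurableT)[+ _].
under eq_integral do rewrite gee0_abs ?lee_fin//=.
move=> /(_ int_f); apply: filterS => y /(_ I) [fy0].
(* It remains to see that f vanishes only where u does. If u y > 0, continuity keeps u above u y / 2
   on an r-ball, and [inf_conv_ge_min] gives f y >= min(u y / 2, 1, r) > 0. *)
apply/eqP; rewrite eq_le u0 andbT leNgt; apply/negP => uy.
have [|r r0 yr] := cu y (u y / 2)%R; first lra.
have := @inf_conv_ge_min _ _ _ dM 1%R v y (Num.min (u y / 2) 1)%R r ltr01 v0.
rewrite -/(f y) fy0 mul1r => min_le0.
have : (Num.min (Num.min (u y / 2) 1) r <= 0)%R.
  apply: min_le0 => z /yr; rewrite ltr_norml => /andP[h1 h2].
  by rewrite /v le_min !ge_min lexx orbT andbT; apply/orP; left; lra.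
by apply/negP; rewrite -ltNge !lt_min r0 ltr01 divr_gt0.
Qed.

Lemma positive_curvature_weakly_strong_m_connected :
  weakly_strong_m_connected d nu m.
Proof.
move=> u u0 _ cu uN0 t t0 x.
have [n un] := exists_integral_mstar_gt0 x u0 cu uN0.
rewrite /heat_semigroup mule_gt0 ?lte_fin ?expR_gt0//.
have term_ge0 k :
    0 <= (t ^+ k / (k`!)%:R)%:E * \int[mstar m k x]_y (u y)%:E.
  apply: mule_ge0; first by rewrite lee_fin divr_ge0 ?exprn_ge0 ?ltW.
  by apply: integral_ge0 => y _; rewrite lee_fin.
(* The partial sum has n.+1 terms, so that the positive n-th term is its last one. *)
apply: lt_le_trans (nneseries_lim_ge n.+1 (fun k _ _ => term_ge0 k)).
rewrite big_nat_recr//=; apply: lt_le_trans (leeDr _ _); last first.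
  by apply: sume_ge0 => k _; exact: term_ge0.
by rewrite mule_gt0// lte_fin divr_gt0 ?exprn_gt0// ltr0n fact_gt0.
Qed.

End positive_curvature.

Theorem theorem2p12 (R : realType) (dX : measure_display)
  (X : measurableType dX) (d : X -> X -> R) (m : R.-pker X ~> X)
  (nu : {measure set X -> \bar R}) :
  metric_random_walk_space d m ->
  radon_measure d nu ->
  invariant_measure nu m ->
  nu setT < +oo ->
  0 < ollivier_ricci d m ->
  m_connected nu m /\ weakly_strong_m_connected d nu m.
Proof.
move=> [[dM _ _] dB _] _ nuP nuT kappa0; split.
  exact: positive_curvature_m_connected dM dB nuP nuT kappa0.
exact: positive_curvature_weakly_strong_m_connected.
Qed.
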